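(* Let $X$ be a zero-dimensional countably controlled space. Then $X^\omega$ is countable dense homogeneous.
   Context: Space means separable metrizable topological space; countable means at most countable. $X^\omega$ is the product of countably infinitely many copies of $X$ with the product topology. A space is zero-dimensional if it has a base of clopen sets. A space is Polish if it admits a complete metric (compatible with its topology). A space $X$ is countably controlled if for every countable $D\subseteq X$ there exists a Polish subspace $G$ of $X$ such that $D\subseteq G\subseteq X$. A space $X$ is countable dense homogeneous if for every pair $(A,B)$ of countable dense subsets of $X$ there exists a homeomorphism $h:X\to X$ such that $h[A]=B$. *)

(* Defs.v *)
From HB Require Import structures.
From mathcomp Require Import all_boot all_order all_algebra.
From mathcomp Require Import all_classical all_reals.
From mathcomp Require Import topology.

Set Implicit Arguments.
Unset Strict Implicit.
Unset Printing Implicit Defensive.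

Import Order.TTheory GRing.Theory Num.Theory.

Local Open Scope classical_set_scope.
Local Open Scope ring_scope.

Definition is_metric (R : realType) (T : Type) (d : T -> T -> R) : Prop :=
  [/\ forall x y, 0 <= d x y,
      forall x y, d x y = 0 <-> x = y,
      forall x y, d x y = d y x &
      forall x y z, d x z <= d x y + d y z].

Definition compatible_metric (R : realType) (T : topologicalType)
    (d : T -> T -> R) : Prop :=
  is_metric d /\
  forall x : T, nbhs x = nbhs_ball_ (fun y e => [set z | d y z < e]) x.

Definition complete_metric (R : realType) (T : topologicalType)
    (d : T -> T -> R) : Prop :=
  forall u : nat -> T,
    (forall e : R, 0 < e ->
       exists N : nat, forall m n : nat,
         (N <= m)%N -> (N <= n)%N -> d (u m) (u n) < e) ->
    exists x : T, u n @[n --> \oo] --> x.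

Definition separable (T : topologicalType) : Prop :=
  exists2 D : set T, countable D & dense D.

Definition separable_metrizable (R : realType) (T : topologicalType) : Prop :=
  separable T /\ exists d : T -> T -> R, compatible_metric d.

Definition polish (R : realType) (T : topologicalType) : Prop :=
  separable T /\
  exists d : T -> T -> R, compatible_metric d /\ complete_metric d.

(* The library's [zero_dimensional] only asks that points be separated by
   clopen sets, which in general is weaker than having a clopen base. *)
Definition has_clopen_basis (T : topologicalType) : Prop :=
  exists2 B : set (set T), basis B & B `<=` clopen.

(* [set_type G] carries the subspace topology, which makes it a space in its
   own right; [subspace G] would instead be a topology on all of [T]. *)
Definition countably_controlled (R : realType) (T : topologicalType) : Prop :=
  forall D : set T, countable D ->
    exists2 G : set T, D `<=` G & polish R (set_type G).

Definition homeomorphism (S T : topologicalType) (h : S -> T) : Prop :=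
  exists g : T -> S,
    [/\ cancel h g, cancel g h, continuous h & continuous g].

Definition countable_dense_homogeneous (T : topologicalType) : Prop :=
  forall A B : set T,
    countable A -> dense A -> countable B -> dense B ->
    exists2 h : T -> T, homeomorphism h & h @` A = B.

(* Main.v *)
(* Let G be a Polish subspace of X containing all coordinates of the points of
   A and B.  For a nonempty clopen P, P * X^omega is homeomorphic to X^omega by
   a homeomorphism preserving the points with coordinates in G: a letter of P
   is held back and threaded through the sequence, and it is forced to a limit
   c in G if it is never released.  Hence all nonempty boxes are homeomorphic,
   and for any two points of G^omega in a box V a homeomorphism supported on V
   carries one to the other.  A back-and-forth argument then composes such
   homeomorphisms.  The n-th one is supported on a box V_n which, with its
   preimage, is of size 1/n in the first n coordinates, both for a metric of X
   and, on G, for a complete metric of G; the boxes are pairwise nested or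
   disjoint.  The successive images of a point of X^omega are eventually
   constant or trapped in boxes shrinking to a point of G^omega, so the
   compositions converge uniformly although X need not be complete. *)
Require Import Defs.
From HB Require Import structures.
From mathcomp Require Import all_boot all_order all_algebra.
From mathcomp Require Import all_classical all_reals.
From mathcomp Require Import topology lra.

Set Implicit Arguments.
Unset Strict Implicit.
Unset Printing Implicit Defensive.

Import Order.TTheory GRing.Theory Num.Theory.

Local Open Scope classical_set_scope.

(** * Countable powers *)

Notation pow X := {ptws nat -> X}.

Definition tail (T : Type) (x : nat -> T) : nat -> T := fun i => x i.+1.

Lemma cvg_pow (X : topologicalType) (F : set_system (pow X)) (y : pow X) :
  Filter F -> (forall i, (fun z : pow X => z i) @ F --> y i) -> F --> y.
Proof.
move=> FF Fy; apply/cvg_sup => i; rewrite cvg_image; last first.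
  (* Constant sequences show that every coordinate map is onto. *)
  by rewrite eqEsubset; split => x _ //; exists (fun=> x).
move=> W /Fy FW; exists ((fun z : pow X => z i) @^-1` W) => //.
by rewrite eqEsubset; split => [x [z Wz <-]|x Wx] //; exists (fun=> x).
Qed.

Lemma cvg_pow_comp (S X : topologicalType) (f : S -> pow X) (s : S) :
  (forall i, (fun z => f z i) @ s --> f s i) -> f @ s --> f s.
Proof. by move=> fs; apply: cvg_pow => i; exact: fs. Qed.

Lemma coord_cvg (X : topologicalType) (i : nat) (y : pow X) :
  z i @[z --> y] --> y i.
Proof. exact: (@proj_continuous nat (fun=> X) i y). Qed.

Lemma nbhs_coord (X : topologicalType) (i : nat) (y : pow X) (Q : set X) :
  nbhs (y i) Q -> \forall z \near y, Q (z i).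
Proof. by move=> Qy; exact: (coord_cvg Qy). Qed.

Lemma clopen_near (T : topologicalType) (Q : set T) (x : T) :
  clopen Q -> Q x -> nbhs x Q.
Proof. by move=> [oQ _] Qx; apply: open_nbhs_nbhs; split. Qed.

Lemma cvg_clopen (S T : topologicalType) (x : S) (f : S -> T) (Q : set T) :
  f @ x --> f x -> clopen Q -> Q (f x) -> \forall z \near x, Q (f z).
Proof. by move=> fx cQ Qx; exact: (fx _ (clopen_near cQ Qx)). Qed.

Lemma cvg_clopenC (S T : topologicalType) (x : S) (f : S -> T) (Q : set T) :
  f @ x --> f x -> clopen Q -> ~ Q (f x) -> \forall z \near x, ~ Q (f z).
Proof. by move=> fx /clopenC cQ; exact: (cvg_clopen fx (cQ setT)). Qed.

Lemma clopenI (T : topologicalType) (P Q : set T) :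
  clopen P -> clopen Q -> clopen (P `&` Q).
Proof. by move=> [oP cP] [oQ cQ]; split; [exact: openI|exact: closedI]. Qed.

Lemma clopenT (T : topologicalType) : clopen (@setT T).
Proof. by split; [exact: openT|exact: closedT]. Qed.

Lemma clopen0 (T : topologicalType) : clopen (@set0 T).
Proof. by split; [exact: open0|exact: closed0]. Qed.

Lemma clopen_preimage (S T : topologicalType) (f : S -> T) (Q : set T) :
  continuous f -> clopen Q -> clopen (f @^-1` Q).
Proof.
move=> cf [oQ cQ]; split; first by move/continuousP : cf => /(_ Q); exact.
by move/continuous_closedP : cf => /(_ Q); exact.
Qed.

Lemma cvg_eq_near (S T : topologicalType) (x : S) (f g : S -> T) :
  (\forall z \near x, f z = g z) -> g @ x --> g x -> f @ x --> f x.
Proof.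
move=> fg gx W; rewrite (nbhs_singleton fg) => /gx.
by apply: filterS2 fg => z /= ->.
Qed.

(** * Absorbing a clopen restriction of one coordinate *)

Section absorb.
Context {X : topologicalType}.
Implicit Types (r : nat -> set X) (p c : X) (x y : nat -> X).

(* The map [(p, y) |-> absorb r p y] from [r 0 * X^omega] to [X^omega] reads
   [y] one letter at a time while holding a letter [p] of [r 0]; each time it
   emits either the letter held or the letter read and holds the other one.
   The letter emitted determines which of the two happened, so the map can be
   inverted. *)
Definition keeps r p (a : X) : bool := `[< r 1 p /\ ~ r 0 a >].

(** The letter held lies in [r 0], and the emitted letter [a] dictates the constraint on the letter
    held next. If [a] is in [r 1], the letter read was in [r 0] and the constraint stays. If [a] is
    in [r 0] but not in [r 1], the letter read was arbitrary. Otherwise [a] is the letter read and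
    the one still held is in [r 1], so the sequence shifts. *)
Definition next r (a : X) : nat -> set X :=
  if `[< r 1 a >] then r else
  if `[< r 0 a >] then (fun=> setT) else (fun i => r i.+1).

Fixpoint absorb r p y (n : nat) : X :=
  let k := keeps r p (y 0) in
  let a := if k then y 0 else p in
  if n is n'.+1 then
    absorb (next r a) (if k then p else y 0) (tail y) n'
  else a.

(* The default value [c] is taken by the letter held when it is never
   emitted. *)
Definition held c r x : X :=
  if pselect (exists i, `[< r i (x i) >]) is left h then x (ex_minn h) else c.

(** A letter emitted from [r 0] was the one held; the letter read at that moment is then held and
    must be recovered from the later emissions. *)
Fixpoint unread c r x (n : nat) : X :=
  if n is n'.+1 then unread c (next r (x 0)) (tail x) n' else
  if `[< r 0 (x 0) >] then held c (next r (x 0)) (tail x) else x 0.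

(** The constant alternative is the state after an unconstrained letter has been taken up: each
    letter is then emitted one step late. In the other alternative, only [c] can be held forever in
    a T1 space. *)
Definition shrinking c r : Prop :=
  [/\ forall i, clopen (r i), forall i, r i.+1 `<=` r i, forall i, r i c &
    (forall i, r i = setT) \/
    (forall N, nbhs c N -> exists i, r i `<=` N)].

Lemma shrinkingT c : shrinking c (fun=> setT).
Proof. by split => // [i|]; [exact: clopenT|left]. Qed.

Lemma shrinkingS c r : shrinking c r -> shrinking c (fun i => r i.+1).
Proof.
move=> [cr dr rc rb]; split => //; case: rb => [rT|rb]; [by left|right].
by move=> N /rb[i riN]; exists i => z /dr; exact: riN.
Qed.

Lemma shrinking_next c r a : shrinking c r -> shrinking c (next r a).
Proof.
move=> sr; rewrite /next; case: ifP => // _; case: ifP => // _.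
  exact: shrinkingT.
exact: shrinkingS.
Qed.

Lemma shrinking_le c r i j : shrinking c r -> (i <= j)%N -> r j `<=` r i.
Proof.
move=> [_ dr _ _] /subnK <-; elim: (j - i) => // k ih z.
by rewrite addSn => /dr; exact: ih.
Qed.

Lemma shrinking_sub c r i : shrinking c r -> r i `<=` r 0.
Proof. by move=> sr; exact: (shrinking_le sr). Qed.

Lemma heldE c r x : shrinking c r ->
  held c r x = if `[< r 0 (x 0) >] then x 0
               else held c (fun i => r i.+1) (tail x).
Proof.
move=> sr; rewrite {1}/held; case: pselect => [h|h]; last first.
  case: asboolP => [r0|nr0]; first by case: h; exists 0; apply/asboolP.
  rewrite /held; case: pselect => // -[i ri].
  by case: h; exists i.+1.
case: ex_minnP => m /asboolP rm mmin; case: asboolP => [r0|nr0].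
  by move/asboolP : r0 => /mmin; rewrite leqn0 => /eqP ->.
case: m rm mmin => // m rm mmin; rewrite /held; case: pselect => [h'|h'].
  case: ex_minnP => k rk kmin; congr (x _).
  apply/eqP; rewrite eqn_leq (mmin k.+1) // ltnS kmin //; exact/asboolP.
by case: h'; exists m; apply/asboolP.
Qed.

Lemma held_in c r x : shrinking c r -> r 0 (held c r x).
Proof.
move=> sr; rewrite /held; case: pselect => [h|_]; last by case: sr.
by case: ex_minnP => m /asboolP rm _; exact: (shrinking_sub sr rm).
Qed.

Hypothesis X_T1 : forall a b : X, (forall N, nbhs a N -> N b) -> a = b.

Lemma absorbS r p y n (k := keeps r p (y 0)) : absorb r p y n.+1 =
  absorb (next r (if k then y 0 else p)) (if k then p else y 0) (tail y) n.
Proof. by []. Qed.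

Lemma next_notin c r a : shrinking c r -> ~ r 0 a -> next r a = fun i => r i.+1.
Proof. by move=> sr nr0; rewrite /next !asboolF // => /(shrinking_sub sr). Qed.

(** As long as no emission meets its [r i], the letter [p] is still held and lies in the current
    set, so the first emission that does is [p] itself. If there is none, [p] lies in all [r i] and
    T1 separation gives [p = c]. *)
Lemma held_absorb c r p y : shrinking c r -> r 0 p ->
  held c r (absorb r p y) = p.
Proof.
have key n : forall r p y, shrinking c r -> r 0 p ->
    (forall i, (i < n)%N -> ~ r i (absorb r p y i)) ->
    r n p /\ (r n (absorb r p y n) -> absorb r p y n = p).
  elim: n => [|n ih] {}r {}p {}y sr rp nr.
    by split => //=; case: ifP => // /asboolP[].
  have kp : keeps r p (y 0).
    by apply: contrapT => /negP/negbTE kF; apply: (nr 0 isT); rewrite /= kF.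
  have /asboolP[r1p nr0y] := kp.
  rewrite absorbS kp (next_notin sr nr0y).
  apply: (ih (fun i => r i.+1)) => //; first exact: shrinkingS.
  by move=> i ilt; have := nr i.+1 ilt; rewrite absorbS kp (next_notin sr nr0y).
move=> sr rp; rewrite /held; case: pselect => [h|h].
  case: ex_minnP => m /asboolP rm mmin.
  have [|_ -> //] := key m _ _ y sr rp.
  by move=> i im /asboolP /mmin; rewrite leqNgt im.
have nr i : ~ r i (absorb r p y i) by move=> ri; case: h; exists i; apply/asboolP.
have rip i : r i p by case: (key i _ _ y sr rp).
case: (sr) => _ _ _ [rT|rb]; first by case: (nr 0); rewrite rT.
by apply: X_T1 => N /rb[i]; apply.
Qed.

(** This is the invariant that lets inductions along the sequence pass to the new constraint and the
    new held letter. *)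
Lemma absorb_next c r p (a : X) : shrinking c r -> r 0 p ->
  let k := keeps r p a in
  next r (if k then a else p) 0 (if k then p else a).
Proof.
move=> sr rp; rewrite /keeps /=; case: asboolP => [[r1p nr0a]|nk].
  by rewrite (next_notin sr).
rewrite /next; case: (asboolP (r 1 p)) => [r1p|nr1p]; last by rewrite asboolT.
by apply: contrapT => nr0a; case: nk.
Qed.

Lemma unread_absorb c r p y n : shrinking c r -> r 0 p ->
  unread c r (absorb r p y) n = y n.
Proof.
elim: n r p y => [|n ih] r p y sr rp.
  have := absorb_next (y 0) sr rp; rewrite /unread.
  have -> : absorb r p y 0 = if keeps r p (y 0) then y 0 else p by [].
  have -> : tail (absorb r p y) = absorb
    (next r (if keeps r p (y 0) then y 0 else p))
    (if keeps r p (y 0) then p else y 0) (tail y) by [].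
  case: ifPn => [/asboolP[r1p nr0y]|nk] rn; first by rewrite asboolF.
  by rewrite asboolT //; apply: held_absorb => //; exact: shrinking_next.
rewrite /unread -/unread [X in next r X]/=.
by apply: ih; [exact: shrinking_next|exact: (absorb_next _ sr)].
Qed.

Lemma absorb_held c r x n : shrinking c r ->
  absorb r (held c r x) (unread c r x) n = x n.
Proof.
(* One step of [absorb] on the decoded data emits [x' 0] and leaves held exactly the letter that the
   tail decodes to. *)
have key r' x' (sr : shrinking c r') :
    let k := keeps r' (held c r' x') (unread c r' x' 0) in
    (if k then unread c r' x' 0 else held c r' x') = x' 0 /\
    (if k then held c r' x' else unread c r' x' 0) =
    held c (next r' (x' 0)) (tail x').
  rewrite /= (heldE _ sr); case: asboolP => [r0x|nr0x].
    rewrite /keeps asboolF //= => -[r1x]; apply.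
    have -> : next r' (x' 0) = r' by rewrite /next asboolT.
    exact: held_in.
  rewrite (next_notin sr) // /keeps asboolT //; split => //.
  exact: (held_in _ (shrinkingS sr)).
elim: n r x => [|n ih] r x sr; have [k1 k2] := key r x sr.
  by rewrite /absorb k1.
rewrite /absorb -/absorb k1 k2; apply: ih; exact: shrinking_next.
Qed.

Lemma absorb_in (G : set X) r p y n : G p -> (forall i, G (y i)) ->
  G (absorb r p y n).
Proof.
elim: n r p y => [|n ih] r p y Gp Gy /=; first by case: ifP.
by apply: ih => [|i]; [case: ifP|exact: Gy].
Qed.

Lemma held_mem (G : set X) c r x : G c -> (forall i, G (x i)) ->
  G (held c r x).
Proof. by move=> Gc Gx; rewrite /held; case: pselect. Qed.

Lemma unread_mem (G : set X) c r x n : G c -> (forall i, G (x i)) ->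
  G (unread c r x n).
Proof.
move=> Gc; elim: n r x => [|n ih] r x Gx /=.
  by case: ifP => // _; apply: (held_mem _ Gc) => i; exact: Gx.
by apply: ih => i; exact: Gx.
Qed.

Lemma near_asbool (S : topologicalType) (s : S) (f : S -> X) (Q : set X) :
  clopen Q -> f @ s --> f s -> \forall z \near s, `[< Q (f z) >] = `[< Q (f s) >].
Proof.
move=> cQ fs; case: (asboolP (Q (f s))) => Qs.
  by apply: filterS (cvg_clopen fs cQ Qs) => z Qz; exact/asboolP.
by apply: filterS (cvg_clopenC fs cQ Qs) => z Qz; exact/asboolP.
Qed.

Lemma near_keeps c r (S : topologicalType) (s : S) (f g : S -> X) :
  shrinking c r -> f @ s --> f s -> g @ s --> g s ->
  \forall z \near s, keeps r (f z) (g z) = keeps r (f s) (g s).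
Proof.
move=> [cr _ _ _] fs gs; near=> z; rewrite /keeps !asbool_and !asbool_neg.
by congr (_ && ~~ _); near: z; exact: near_asbool.
Unshelve. all: by end_near. Qed.

Lemma near_next c r (S : topologicalType) (s : S) (f : S -> X) :
  shrinking c r -> f @ s --> f s ->
  \forall z \near s, next r (f z) = next r (f s).
Proof.
move=> [cr _ _ _] fs; near=> z; rewrite /next.
have -> : `[< r 1 (f z) >] = `[< r 1 (f s) >] by near: z; exact: near_asbool.
have -> // : `[< r 0 (f z) >] = `[< r 0 (f s) >].
by near: z; exact: near_asbool.
Unshelve. all: by end_near. Qed.

(** Every decision is membership in a clopen set, hence locally constant; for a fixed run of
    decisions each output letter is one of the input letters. *)
Lemma absorb_cvg (S : topologicalType) (s : S) c r (p : S -> X)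
    (y : S -> nat -> X) n :
  shrinking c r -> p @ s --> p s -> (forall i, y^~ i @ s --> y s i) ->
  (fun z => absorb r (p z) (y z) n) @ s --> absorb r (p s) (y s) n.
Proof.
elim: n r p y => [|n ih] r p y sr ps ys; have nk := near_keeps sr ps (ys 0).
  apply: (@cvg_eq_near _ _ _ _
    (fun z => if keeps r (p s) (y s 0) then y z 0 else p z)).
    by apply: filterS nk => z /= ->.
  by case: keeps; [exact: ys|].
pose a z := if keeps r (p s) (y s 0) then y z 0 else p z.
have as_ : a @ s --> a s by rewrite /a; case: keeps; [exact: ys|].
have nn := near_next sr as_.
apply: (@cvg_eq_near _ _ _ _ (fun z => absorb (next r (a s))
    (if keeps r (p s) (y s 0) then p z else y z 0) (tail (y z)) n)).
  near=> z => /=.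
  have -> : keeps r (p z) (y z 0) = keeps r (p s) (y s 0) by near: z.
  by rewrite -/(a z); have -> : next r (a z) = next r (a s) by near: z.
apply: (ih _ (fun z => if keeps r (p s) (y s 0) then p z else y z 0)
  (fun z => tail (y z))) => [||i]; last exact: ys.
  exact: shrinking_next.
by case: keeps => //; exact: ys.
Unshelve. all: by end_near. Qed.

Lemma held_cvg (S : topologicalType) (s : S) c r (x : S -> nat -> X) :
  shrinking c r -> (forall i, x^~ i @ s --> x s i) ->
  (fun z => held c r (x z)) @ s --> held c r (x s).
Proof.
move=> sr xs.
have [[i rix]|h] := pselect (exists i, r i (x s i)).
  elim: i r x sr xs rix => [|i ih] r x sr xs rix; have [cr _ _ _] := sr.
    apply: (@cvg_eq_near _ _ _ _ (fun z => x z 0)) => //.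
    apply: filterS (cvg_clopen (xs 0) (cr 0) rix) => z rz.
    by rewrite heldE // asboolT.
  have [r0|nr0] := pselect (r 0 (x s 0)).
    apply: (@cvg_eq_near _ _ _ _ (fun z => x z 0)) => //.
    apply: filterS (cvg_clopen (xs 0) (cr 0) r0) => z rz.
    by rewrite heldE // asboolT.
  apply: (@cvg_eq_near _ _ _ _
     (fun z => held c (fun i => r i.+1) (tail (x z)))).
    apply: filterS (cvg_clopenC (xs 0) (cr 0) nr0) => z rz.
    by rewrite heldE // asboolF.
  by apply: ih => // [|j]; [exact: shrinkingS|exact: xs].
(* Here nothing is ever released at [s]. Nearby sequences release nothing in the first [n] steps, so
   their held letter is [c] or comes from a later set, and lies in [r n]. *)
have -> : held c r (x s) = c.
  rewrite /held; case: pselect => // -[i ri]; case: h; exists i; exact/asboolP.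
have [cr dr rc rb] := sr.
case: rb => [rT|rb]; first by case: h; exists 0; rewrite rT.
move=> N /rb[n rnN].
have /= : \forall z \near s, forall i : 'I_n, ~ r i (x z i).
  apply: filter_forall => i; apply: (cvg_clopenC (xs i) (cr i)) => ri.
  by apply: h; exists i.
apply: filterS => z nrz /=; rewrite /held.
case: pselect => [h'|_]; last exact/rnN/rc.
case: ex_minnP => m /asboolP rm _; apply: rnN.
apply: (shrinking_le sr _ rm); rewrite leqNgt; apply/negP => mn.
exact: (nrz (Ordinal mn)).
Qed.

Lemma unread_cvg (S : topologicalType) (s : S) c r (x : S -> nat -> X) n :
  shrinking c r -> (forall i, x^~ i @ s --> x s i) ->
  (fun z => unread c r (x z) n) @ s --> unread c r (x s) n.
Proof.
elim: n r x => [|n ih] r x sr xs; have nn := near_next sr (xs 0).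
  have [cr _ _ _] := sr; have n0 := near_asbool (cr 0) (xs 0).
  apply: (@cvg_eq_near _ _ _ _ (fun z => if `[< r 0 (x s 0) >]
      then held c (next r (x s 0)) (tail (x z)) else x z 0)).
    near=> z; rewrite /unread.
    have -> : next r (x z 0) = next r (x s 0) by near: z.
    by have -> : `[< r 0 (x z 0) >] = `[< r 0 (x s 0) >] by near: z.
  case: ifP => // _; apply: (@held_cvg _ _ _ _ (fun z => tail (x z))).
    exact: shrinking_next.
  by move=> i; exact: xs.
apply: (@cvg_eq_near _ _ _ _
    (fun z => unread c (next r (x s 0)) (tail (x z)) n)).
  by apply: filterS nn => z /= ->.
apply: (ih _ (fun z => tail (x z))) => [|i]; last exact: xs.
exact: shrinking_next.
Unshelve. all: by end_near. Qed.

End absorb.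

(** * Local homogeneity of the pair (X^omega, G^omega) *)

Section pair_homeomorphisms.
Context {Y : topologicalType} (H : set Y).
Implicit Types (C : set Y) (f g : Y -> Y).

(** The maps are total, but only their values on [C] matter. Continuity is taken in the whole space,
    which amounts to continuity on [C] for the clopen sets considered below. *)
Definition carries C C' f g : Prop :=
  forall x, C x -> [/\ C' (f x), g (f x) = x, H x -> H (f x) & f @ x --> f x].

Definition pair_homeo C C' : Prop :=
  exists f g, carries C C' f g /\ carries C' C g f.

Lemma carries_id C : carries C C id id.
Proof. by move=> x Cx; split => //; exact: cvg_id. Qed.

Lemma carries_comp C1 C2 C3 f1 g1 f2 g2 :
  carries C1 C2 f1 g1 -> carries C2 C3 f2 g2 ->
  carries C1 C3 (f2 \o f1) (g1 \o g2).
Proof.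
move=> c12 c23 x /c12[C2x f1K H1 f1x]; have [C3x f2K H2 f2x] := c23 _ C2x.
split => //=; first by rewrite f2K.
  by move=> /H1 /H2.
exact: cvg_comp f1x f2x.
Qed.

Lemma pair_homeo_refl C : pair_homeo C C.
Proof. by exists id, id; split; exact: carries_id. Qed.

Lemma pair_homeo_sym C C' : pair_homeo C C' -> pair_homeo C' C.
Proof. by move=> [f [g [fg gf]]]; exists g, f. Qed.

Lemma pair_homeo_trans C1 C2 C3 :
  pair_homeo C1 C2 -> pair_homeo C2 C3 -> pair_homeo C1 C3.
Proof.
move=> [f1 [g1 [c1 d1]]] [f2 [g2 [c2 d2]]].
exists (f2 \o f1), (g1 \o g2).
by split; [exact: carries_comp c1 c2|exact: carries_comp d2 d1].
Qed.

End pair_homeomorphisms.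

(** * Gluing homeomorphisms of clopen rings around a point *)

Section glue.
Context {Y : topologicalType} (H : set Y).
Hypothesis Y_T1 : forall a b : Y, (forall N, nbhs a N -> N b) -> a = b.

Definition filtration (W : nat -> set Y) (z : Y) : Prop :=
  [/\ forall k, clopen (W k), forall k, W k.+1 `<=` W k, forall k, W k z &
    forall N, nbhs z N -> exists k, W k `<=` N].

(** The rings of a filtration partition [W 0] without its centre, so the value [b] is taken at the
    centre only. *)
Definition glue (W : nat -> set Y) (b : Y) (f : nat -> Y -> Y) (x : Y) : Y :=
  if pselect (W 0 x) then
    if pselect (exists k, (W k `\` W k.+1) x) is left h then f (projT1 (cid h)) x
    else b
  else x.

Lemma filtration_le W z i j : filtration W z -> (i <= j)%N -> W j `<=` W i.
Proof.
move=> [_ dW _ _] /subnK <-; elim: (j - i) => // k ih x.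
by rewrite addSn => /dW; exact: ih.
Qed.

Lemma filtration_center W z x : filtration W z -> W 0 x ->
  ~ (exists k, (W k `\` W k.+1) x) -> x = z.
Proof.
move=> [_ _ _ bW] W0 nk.
have Wx k : W k x.
  by elim: k => // k ih; apply: contrapT => nW; apply: nk; exists k.
by apply: esym; apply: Y_T1 => N /bW[k]; apply.
Qed.

Lemma glueE W z b f k x : filtration W z -> (W k `\` W k.+1) x ->
  glue W b f x = f k x.
Proof.
move=> sW Wk; rewrite /glue; case: pselect => [W0|nW] /=; last first.
  by case: nW; have [Wx _] := Wk; exact: (filtration_le sW (leq0n k) Wx).
case: pselect => [h|h]; last by case: h; exists k.
case: cid => j Wj /=; congr (f _ x).
case: Wj Wk => [Wj nWj] [Wk nWk]; apply/eqP; rewrite eqn_leq.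
apply/andP; split; rewrite leqNgt; apply/negP => jk.
  by apply: nWk; exact: (filtration_le sW jk).
by apply: nWj; exact: (filtration_le sW jk).
Qed.

Lemma glue_center W z b f : filtration W z -> glue W b f z = b.
Proof.
move=> [_ _ Wz _]; rewrite /glue; case: pselect => [Wz0|//] /=.
by case: pselect => [h|//]; case: (h) => k [].
Qed.

Lemma glue_out W b f x : ~ W 0 x -> glue W b f x = x.
Proof. by move=> nW; rewrite /glue; case: pselect. Qed.

(** Rings are clopen, so off the centre the glued map agrees locally with one [f k] or with the
    identity. At the centre it is continuous because points of [W k] land in [W' k]. *)
Lemma carries_glue W z W' b f g :
  filtration W z -> filtration W' b -> W 0 = W' 0 -> H b ->
  (forall k, carries H (W k `\` W k.+1) (W' k `\` W' k.+1) (f k) (g k)) ->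
  carries H setT setT (glue W b f) (glue W' z g).
Proof.
move=> sW sW' WW' Hb fg x _; have [cW _ Wz bW] := sW; have [_ _ W'b bW'] := sW'.
have [W0|nW0] := pselect (W 0 x); last first.
  have -> : glue W' z g (glue W b f x) = x by rewrite !glue_out // -WW'.
  split => //; first by rewrite glue_out.
  apply: (@cvg_eq_near _ _ _ _ id) => //.
  apply: filterS (cvg_clopenC (@cvg_id _ _) (cW 0) nW0) => y; exact: glue_out.
have [[k Wk]|nk] := pselect (exists k, (W k `\` W k.+1) x).
  have [W'k fK Hf fx] := fg k _ Wk.
  rewrite (glueE _ _ sW Wk) (glueE _ _ sW' W'k); split => //.
  rewrite -(glueE b f sW Wk); apply: cvg_eq_near fx.
  near=> y; apply: (glueE _ _ sW); split.
    by near: y; apply: clopen_near; case: Wk.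
  by near: y; apply: clopen_near; [exact: clopenC|case: Wk].
rewrite (filtration_center sW W0 nk) !(glue_center _ _ sW) (glue_center _ _ sW').
split => // N /bW'[k kN].
have := clopen_near (cW k) (Wz k); apply: filterS => y Wky /=; apply: kN.
have [[j Wj]|nj] := pselect (exists j, (W j `\` W j.+1) y); last first.
  have Wy : W 0 y by exact: (filtration_le sW (leq0n k) Wky).
  by rewrite (filtration_center sW Wy nj) (glue_center _ _ sW).
rewrite (glueE _ _ sW Wj); have [[W'j _] _ _ _] := fg j _ Wj.
apply: (filtration_le sW' _ W'j); rewrite leqNgt; apply/negP => jk.
by case: Wj => _; apply; exact: (filtration_le sW jk).
Unshelve. all: by end_near. Qed.

Lemma local_homogeneity V z b (W W' : nat -> set Y) :
  H z -> H b -> W 0 = V -> W' 0 = V -> filtration W z -> filtration W' b ->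
  (forall k, pair_homeo H (W k `\` W k.+1) (W' k `\` W' k.+1)) ->
  exists f g, [/\ carries H setT setT f g, carries H setT setT g f,
    f z = b & (forall x, ~ V x -> f x = x) /\ (forall x, V x -> V (f x))].
Proof.
move=> Hz Hb W0 W'0 sW sW' WW'.
have /choice[f /choice[g fg]] := WW'.
exists (glue W b f), (glue W' z g); split.
- by apply: carries_glue; rewrite ?W0 // => k; case: (fg k).
- by apply: carries_glue; rewrite ?W0 // => k; case: (fg k).
- exact: glue_center.
- split=> x Vx; first by rewrite glue_out // W0.
  have [[k Wk]|nk] := pselect (exists k, (W k `\` W k.+1) x).
    rewrite (glueE _ _ sW Wk); have [/(_ _ Wk)[[W'k _] _ _ _] _] := fg k.
    by rewrite -W'0; exact: (filtration_le sW' (leq0n k) W'k).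
  rewrite (filtration_center sW _ nk) ?W0 // (glue_center _ _ sW) -W'0.
  by case: sW'.
Qed.

End glue.

(** * Boxes in the countable power *)

Section boxes.
Context {X : topologicalType} (G : set X).
Hypothesis X_T1 : forall a b : X, (forall N, nbhs a N -> N b) -> a = b.
Hypothesis X_base : forall a : X, exists r : nat -> set X,
  [/\ forall i, clopen (r i), forall i, r i.+1 `<=` r i, forall i, r i a &
    forall N, nbhs a N -> exists i, r i `<=` N].
Hypothesis G_dense : dense G.
Hypothesis X_nontrivial : exists a b : X, a <> b.

Definition cube : set (pow X) := [set x | forall i, G (x i)].

Definition splice n (F : (nat -> X) -> nat -> X) (x : pow X) : pow X :=
  fun i => if (i < n)%N then x i else F (fun j => x (n + j)%N) (i - n)%N.

Lemma splice_lt n F x i : (i < n)%N -> splice n F x i = x i.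
Proof. by rewrite /splice => ->. Qed.

Lemma splice_add n F x j : splice n F x (n + j)%N = F (fun j => x (n + j)%N) j.
Proof. by rewrite /splice ltnNge leq_addr /= addKn. Qed.

Lemma spliceK n F F' x :
  (forall j, F' (F (fun j => x (n + j)%N)) j = x (n + j)%N) ->
  splice n F' (splice n F x) = x.
Proof.
move=> FK; apply: funext => i; have [ilt|nle] := ltnP i n.
  by rewrite !splice_lt.
rewrite -(subnKC nle) splice_add -FK; congr (F' _ _).
by apply: funext => j; rewrite splice_add.
Qed.

Lemma splice_cvg n (F : (nat -> X) -> nat -> X) (x : pow X) :
  (forall k, (fun z : pow X => F (fun j => z (n + j)%N) k) @ x -->
     F (fun j => x (n + j)%N) k) ->
  splice n F @ x --> splice n F x.
Proof.
move=> Fx; apply: cvg_pow_comp => i; rewrite /splice.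
by case: ifP => _; [exact: coord_cvg|exact: Fx].
Qed.

Definition box n (P : nat -> set X) : set (pow X) :=
  [set x | forall i, (i < n)%N -> P i (x i)].

Lemma boxS n P : box n.+1 P = box n P `&` [set x | P n (x n)].
Proof.
rewrite eqEsubset; split => [x Px|x [Px Pn] i].
  by split => [i ilt|]; apply: Px => //; exact: ltnW.
by rewrite ltnS leq_eqVlt => /orP[/eqP ->|/Px].
Qed.

Lemma clopen_coord i (Q : set X) : clopen Q -> clopen [set x : pow X | Q (x i)].
Proof.
move=> cQ; apply: (@clopen_preimage _ _ (fun x : pow X => x i)) => // x.
exact: coord_cvg.
Qed.

Lemma clopen_box n P : (forall i, clopen (P i)) -> clopen (box n P).
Proof.
move=> cP; elim: n => [|n ih]; last first.
  by rewrite boxS; apply: clopenI => //; exact: clopen_coord.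
suff -> : box 0 P = setT by exact: clopenT.
by rewrite eqEsubset; split.
Qed.

(* Restricting one more coordinate does not change the homeomorphism type:
   [absorb], applied to the coordinates from [n] on, removes the restriction. *)
Lemma box_pair_homeo n P : (forall i, clopen (P i)) -> box n P !=set0 ->
  pair_homeo cube (box n P) setT.
Proof.
move=> cP; elim: n => [|n ih] [x0 Px0].
  suff -> : box 0 P = setT by exact: pair_homeo_refl.
  by rewrite eqEsubset; split.
have bn : box n P !=set0 by exists x0; move: Px0; rewrite boxS => -[].
apply: pair_homeo_trans (ih bn).
(* Density of [G] provides a default letter in [G], which keeps the decoding inside [cube]. *)
have [c [Pc Gc]] : P n `&` G !=set0.
  by apply: G_dense; [exists (x0 n); exact: Px0|have [] := cP n].
have [r [cr dr rc rb]] := X_base c.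
(* The sequence starts with all of [P n], so that the held letter ranges over exactly [P n]. *)
pose s i := if i is i'.+1 then P n `&` r i' else P n.
have sr : shrinking c s.
  split.
  - by case=> [|i] //=; exact: clopenI.
  - by case=> [|i] z /= []// ? /dr.
  - by case.
  - by right => N /rb[i riN]; exists i.+1 => z [_]; exact: riN.
pose F (t : nat -> X) := absorb s (t 0) (tail t).
pose F' (t : nat -> X) k :=
  if k is k'.+1 then unread c s t k' else held c s t.
exists (splice n F), (splice n F'); split => x Px.
- split.
  + by move=> i ilt; rewrite splice_lt //; apply: Px; exact: ltnW.
  + apply: spliceK => -[|k]; rewrite /F' /F.
      by rewrite held_absorb // addn0; apply: Px.
    by rewrite (unread_absorb X_T1 _ _ sr) // addn0; apply: Px.
  + move=> Gx i; have [ilt|nle] := ltnP i n; first by rewrite splice_lt.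
    by rewrite -(subnKC nle) splice_add; apply: absorb_in => // j; exact: Gx.
  + apply: splice_cvg => k.
    apply: (@absorb_cvg _ _ _ c s (fun z : pow X => z (n + 0)%N)
      (fun (z : pow X) j => z (n + j.+1)%N)) => // [|i]; exact: coord_cvg.
- split.
  + rewrite boxS; split => [i ilt|/=]; first by rewrite splice_lt //; exact: Px.
    by have := splice_add n F' x 0; rewrite addn0 => ->; exact: (held_in _ sr).
  + apply: spliceK => k; rewrite /F' /F; exact: absorb_held.
  + move=> Gx i; have [ilt|nle] := ltnP i n; first by rewrite splice_lt.
    rewrite -(subnKC nle) splice_add /F'.
    by case: (i - n)%N => [|k]; [apply: held_mem|apply: unread_mem].
  + apply: splice_cvg => -[|k].
      apply: (@held_cvg _ _ _ c s (fun (z : pow X) j => z (n + j)%N)) => // i.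
      exact: coord_cvg.
    apply: (@unread_cvg _ _ _ c s (fun (z : pow X) j => z (n + j)%N)) => // i.
    exact: coord_cvg.
Qed.

Definition is_box (W : set (pow X)) : Prop :=
  exists n P, (forall i, clopen (P i)) /\ W = box n P.

Lemma is_box_clopen W : is_box W -> clopen W.
Proof. by move=> [n [P [cP ->]]]; exact: clopen_box. Qed.

Lemma is_boxT : is_box setT.
Proof.
exists 0, (fun=> setT); split; first by move=> _; exact: clopenT.
by rewrite eqEsubset; split.
Qed.

Lemma is_boxI W i Q : is_box W -> clopen Q -> is_box (W `&` [set x | Q (x i)]).
Proof.
move=> [n [P [cP ->]]] cQ.
exists (maxn n i.+1), (fun j => (if (j < n)%N then P j else setT) `&`
  (if j == i then Q else setT)); split.
  move=> j; apply: clopenI; case: ifP => // _; exact: clopenT.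
rewrite eqEsubset; split => [x [Px Qx] j _|x h].
  by split; [case: ifP => // /Px|case: ifP => // /eqP ->].
split=> [j ilt|/=].
  by have [|+ _] := h j; rewrite ?leq_max ilt.
by have [|_] := h i; rewrite ?leq_max ?eqxx ?ltnSn ?orbT.
Qed.

(** Restricting one coordinate leaves a box as difference, which is homeomorphic to the whole power
    once it is nonempty. If the restriction by [Q] removes nothing from [W], the cut is made instead
    at a coordinate left free by [W], where a second letter exists. *)
Lemma box_cut W z i Q : is_box W -> W z -> clopen Q -> Q (z i) ->
  exists W', [/\ is_box W', W' `<=` W, W' z, W' `<=` [set x | Q (x i)] &
    pair_homeo cube (W `\` W') setT].
Proof.
have cut m R : is_box W -> W z -> clopen R -> R (z m) ->
    (W `&` [set x | ~ R (x m)]) !=set0 ->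
    exists W', [/\ is_box W', W' `<=` W, W' z, W' `<=` [set x | R (x m)] &
      pair_homeo cube (W `\` W') setT].
  move=> bW Wz cR Rz ne; exists (W `&` [set x | R (x m)]); split => //.
  - exact: (is_boxI m bW cR).
  - have -> : W `\` (W `&` [set x | R (x m)]) = W `&` [set x | ~ R (x m)].
      rewrite eqEsubset; split=> x [Wx nR]; split => //.
        by move=> Rx; exact: nR.
      by move=> [_].
    have [n [P [cP eW]]] := is_boxI m bW (clopenC setT cR).
    rewrite eW; apply: box_pair_homeo => //; rewrite -eW; exact: ne.
move=> bW Wz cQ Qz.
have [ne|WQ] := pselect ((W `&` [set x | ~ Q (x i)]) !=set0); first exact: cut.
have [n [P [cP eW]]] := bW.
have [d dzn] : exists d, z n <> d.
  have [a [b ab]] := X_nontrivial; have [za|] := pselect (z n = a).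
    by exists b; rewrite za.
  by exists a.
have [R [cR Rz nRd]] : exists R, [/\ clopen R, R (z n) & ~ R d].
  apply: contrapT => nR; apply: dzn; apply: X_T1 => N.
  have [r [cr _ rz rb]] := X_base (z n).
  move=> /rb[j]; apply; apply: contrapT => nrd.
  by apply: nR; exists (r j).
have [|W' [bW' W'W W'z W'R hW']] := cut n R bW Wz cR Rz.
  exists (fun j => if j == n then d else z j); split; last by rewrite /= eqxx.
  move: Wz; rewrite eW => Wz j jn; rewrite (ltn_eqF jn); exact: Wz.
exists W'; split => // x W'x /=; apply: contrapT => nQ.
by apply: WQ; exists x; split => //; exact: W'W.
Qed.

(** When [k] codes the pair [(i, j)], the [k]-th cut confines coordinate [i] to the [j]-th base set
    at [z i]. All pairs occur, so the boxes form a base at [z]. *)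
Lemma box_filtration V z : is_box V -> V z -> exists W : nat -> set (pow X),
  [/\ W 0 = V, forall k, is_box (W k), filtration W z &
    forall k, pair_homeo cube (W k `\` W k.+1) setT].
Proof.
move=> bV Vz.
have /choice[r rP] := fun i => X_base (z i).
pose T := {W : set (pow X) | is_box W /\ W z}.
pose good (k : nat) (W W' : T) := [/\ sval W' `<=` sval W,
  pair_homeo cube (sval W `\` sval W') setT &
  forall i j, unpickle k = Some (i, j) ->
    sval W' `<=` [set x | r i j (x i)]].
have step kW : exists W', good kW.1 kW.2 W'.
  case: kW => k [W [bW Wz]] /=.
  (* The pair [(0, 0)] serves when [k] codes no pair: a cut is still required, since every ring must
     be nonempty. *)
  have [[i j] kij] : exists ij : nat * nat,
      forall i j, unpickle k = Some (i, j) -> ij = (i, j).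
    case: (unpickle k) => [ij|]; first by exists ij => i j [].
    by exists (0, 0).
  have [cr _ rz _] := rP i.
  have [W' [bW' W'W W'z W'r hW']] := box_cut bW Wz (cr j) (rz j).
  exists (exist _ W' (conj bW' W'z)); split => // i' j' /kij [<- <-].
  exact: W'r.
have [f fP] := choice step.
pose W := nat_rect (fun=> T) (exist _ V (conj bV Vz)) (fun k W => f (k, W)).
have gW k : good k (W k) (W k.+1) by exact: (fP (k, W k)).
exists (fun k => sval (W k)); split => //.
- by move=> k; case: (svalP (W k)).
- have WS k : sval (W k.+1) `<=` sval (W k) by case: (gW k).
  have Wle i j : (i <= j)%N -> sval (W j) `<=` sval (W i).
    move=> /subnK <-; elim: (j - i) => // m ih x.
    by rewrite addSn => /WS; exact: ih.
  split => //.
  + by move=> k; apply: is_box_clopen; case: (svalP (W k)).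
  + by move=> k; case: (svalP (W k)).
  + pose F := filter_from setT (fun k => sval (W k)).
    have FF : Filter F.
      apply: filter_fromT_filter; first by exists 0.
      move=> i j; exists (maxn i j) => x Wx.
      by split; apply: Wle Wx; rewrite leq_max leqnn ?orbT.
    have Fz : F --> z.
      apply: cvg_pow => i N zN; have [_ _ _ rb] := rP i.
      have [j rjN] := rb N zN; exists (pickle (i, j)).+1 => // x Wx.
      have [_ _ /(_ i j)] := gW (pickle (i, j)).
      by rewrite pickleK => /(_ erefl _ Wx) /rjN.
    by move=> N /Fz[k _ WkN]; exists k.
- by move=> k; case: (gW k).
Qed.

Lemma nbhs_box z N : nbhs z N -> exists V, [/\ is_box V, V z & V `<=` N].
Proof.
have [W [_ bW [_ _ Wz Wb] _]] := box_filtration is_boxT (I : setT z).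
by move=> /Wb[k WkN]; exists (W k).
Qed.

Lemma pow_T1 (a b : pow X) : (forall N, nbhs a N -> N b) -> a = b.
Proof.
move=> ab; apply: funext => i; apply: X_T1 => N aN.
exact: (ab _ (nbhs_coord aN)).
Qed.

(** All rings around [z] and [b] are homeomorphic to the whole power, hence rings of equal index to
    each other. *)
Lemma box_homogeneity V z b : is_box V -> V z -> V b -> cube z -> cube b ->
  exists f g, [/\ carries cube setT setT f g, carries cube setT setT g f,
    f z = b & (forall x, ~ V x -> f x = x) /\ (forall x, V x -> V (f x))].
Proof.
move=> bV Vz Vb Gz Gb.
have [W [W0 _ sW hW]] := box_filtration bV Vz.
have [W' [W'0 _ sW' hW']] := box_filtration bV Vb.
apply: (local_homogeneity pow_T1 Gz Gb W0 W'0 sW sW') => k.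
exact: pair_homeo_trans (hW k) (pair_homeo_sym (hW' k)).
Qed.

End boxes.

(** * Limits of homeomorphisms modified on shrinking sets *)

Definition rate (R : realType) (n : nat) : R := (n.+1%:R^-1)%R.

Lemma rate_gt0 (R : realType) n : (0 < rate R n)%R.
Proof. by rewrite invr_gt0 ltr0n. Qed.

Lemma rate_le (R : realType) (n m : nat) : (n <= m)%N ->
  (rate R m <= rate R n)%R.
Proof. by move=> nm; rewrite lef_pV2 ?posrE ?ltr0n // ler_nat. Qed.

Lemma rate_lt (R : realType) (e : R) : (0 < e)%R -> exists n, (rate R n < e)%R.
Proof. by move=> /ltr_add_invr[n]; rewrite add0r; exists n. Qed.

Section metric.
Local Open Scope ring_scope.
Context {R : realType} {T : topologicalType} (d : T -> T -> R).
Hypothesis dP : compatible_metric d.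

Lemma dist_ge0 x y : 0 <= d x y. Proof. by case: dP => -[]. Qed.

Lemma distxx x : d x x = 0. Proof. by case: dP => -[_ /(_ x x)[_ ->]]. Qed.

Lemma dist_sym x y : d x y = d y x. Proof. by case: dP => -[]. Qed.

Lemma dist_triangle y x z : d x z <= d x y + d y z.
Proof. by case: dP => -[]. Qed.

Lemma dist_le_eq x y : (forall e, 0 < e -> d x y <= e) -> x = y.
Proof.
case: dP => -[_ d0 _ _] _ xy; apply/d0/eqP; rewrite eq_le dist_ge0 andbT.
rewrite leNgt; apply/negP => dxy; have := xy (d x y / 2) ltac:(lra); lra.
Qed.

Lemma nbhs_dist x e : 0 < e -> nbhs x [set y | d x y < e].
Proof. by case: dP => _ -> e0; exists e. Qed.

Lemma dist_nbhs x N : nbhs x N -> exists2 e, 0 < e & [set y | d x y < e] `<=` N.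
Proof. by case: dP => _ -> [e e0 eN]; exists e. Qed.

Lemma metric_T1 (a b : T) : (forall N, nbhs a N -> N b) -> a = b.
Proof.
move=> ab; apply: dist_le_eq => e e0; apply: ltW; exact: (ab _ (nbhs_dist a e0)).
Qed.

Lemma metric_clopen_base a : has_clopen_basis T ->
  exists r : nat -> set T,
  [/\ forall i, clopen (r i), forall i, r i.+1 `<=` r i, forall i, r i a &
    forall N, nbhs a N -> exists i, r i `<=` N].
Proof.
move=> [B [_ bB] cB].
have ex N : nbhs a N -> exists Q, [/\ clopen Q, Q a & Q `<=` N].
  by move=> /bB[Q [BQ Qa] QN]; exists Q; split => //; exact: cB.
have /choice[Q QP] n := ex _ (nbhs_dist a (rate_gt0 R n)).
pose r := fix r n := if n is n'.+1 then r n' `&` Q n else Q 0%N.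
have cr n : clopen (r n).
  elim: n => [|n ih] /=; first by case: (QP 0%N).
  by apply: clopenI => //; case: (QP n.+1).
have ra n : r n a.
  elim: n => [|n ih] /=; first by case: (QP 0%N).
  by split => //; case: (QP n.+1).
exists r; split => // [i x []//|N /dist_nbhs[e egt0 eN]].
have [n ne] := rate_lt egt0.
exists n => x rx; apply: eN; have [_ _ /(_ x)] := QP n.
move=> h /=; apply: lt_trans ne; apply: h.
by case: n rx => // n [].
Qed.

End metric.

Section limits.
Local Open Scope ring_scope.
Context {R : realType} {X : topologicalType} (G : set X).
Context (d : X -> X -> R) (rho : set_type G -> set_type G -> R).
Hypotheses (dP : compatible_metric d) (rhoP : compatible_metric rho).
Hypotheses (rho_complete : complete_metric rho) (G_dense : dense G).

(** The bound on [d] controls all points; the bound on [rho], available only in [G], yields Cauchy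
    sequences for the complete metric. *)
Definition small_set (n : nat) (V : set X) : Prop :=
  (forall x y, V x -> V y -> d x y < rate R n) /\
  (forall x y : set_type G, V (set_val x) -> V (set_val y) ->
     rho x y < rate R n).

Lemma small_set_le n m V : (n <= m)%N -> small_set m V -> small_set n V.
Proof.
move=> nm [dV rV].
split=> x y Vx Vy; apply: lt_le_trans (rate_le R nm); [exact: dV|exact: rV].
Qed.

Lemma near_small_set n c : G c -> exists V, [/\ open V, V c & small_set n V].
Proof.
move=> Gc.
have q0 := rate_gt0 R n; have e0 : 0 < rate R n / 2 by lra.
pose c' : set_type G := exist _ c (mem_set Gc).
(* The [rho]-ball contains the trace on [G] of an open set [O] of [X]. *)
have [_ [[O oO <-] Oc sO]] := nbhs_dist rhoP c' e0.
exists ([set y | d c y < rate R n / 2]° `&` O); split.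
- by apply: openI => //; exact: open_interior.
- by split => //; exact: (nbhs_dist dP).
- split=> x y [/interior_subset dx Ox] [/interior_subset dy Oy].
    have := dist_triangle dP c x y; rewrite (dist_sym dP x c).
    rewrite /= in dx dy; lra.
  have /= rx := sO x Ox; have /= ry := sO y Oy.
  have := dist_triangle rhoP c' x y; rewrite (dist_sym rhoP x c'); lra.
Qed.

(** This replaces completeness of [X]. Finite intersections of the small open sets meet the dense
    set [G]; points chosen there are [rho]-Cauchy, and [F] converges to their limit because the sets
    are also [d]-small. *)
Lemma small_sets_cvg (F : set_system X) : ProperFilter F ->
  (forall n, exists V, [/\ open V, small_set n V & F V]) ->
  exists x : X, F --> x.
Proof.
move=> PF /choice[V VP].
pose W := fix W n := if n is n'.+1 then W n' `&` V n else V 0%N.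
have WP n : open (W n) /\ F (W n).
  elim: n => [|n [oW FW]] /=; first by have [] := VP 0%N.
  have [oV _ FV] := VP n.+1.
  by split; [exact: openI|exact: filterI].
have WV n m : (n <= m)%N -> W m `<=` V n.
  elim: m => [|m ih]; first by rewrite leqn0 => /eqP ->.
  by rewrite leq_eqVlt => /orP[/eqP -> x []//|/ih nm x [/nm]].
have /choice[v vW] n : exists v : set_type G, W n (set_val v).
  have [oW FW] := WP n; have [x [Wx Gx]] := G_dense (filter_ex FW) oW.
  by exists (exist _ x (mem_set Gx)).
have [g vg] : exists g : set_type G, v n @[n --> \oo] --> g.
  apply: rho_complete => e e0; have [N Ne] := rate_lt e0.
  exists N => m n Nm Nn; apply: lt_trans Ne.
  have [_ [_ rV] _] := VP N.
  by apply: rV; [exact: WV Nm _ (vW m)|exact: WV Nn _ (vW n)].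
exists (set_val g) => N /(dist_nbhs dP)[e e0 eN].
have e2 : 0 < e / 2 by lra.
have [k ke] := rate_lt e2.
have vg' : \forall n \near \oo, d (set_val g) (set_val (v n)) < e / 2.
  exact: (vg _ (@initial_continuous (set_type G) X set_val g _
    (nbhs_dist dP (set_val g) e2))).
have [n [kn vn]] : exists n, (k <= n)%N /\ d (set_val g) (set_val (v n)) < e / 2.
  exact: (filter_ex (filterI (nbhs_infty_ge k) vg')).
have [_ [dV _] FV] := VP k.
apply: filterS FV => x Vx; apply: eN => /=.
have := dist_triangle dP (set_val (v n)) (set_val g) x.
have := dV _ _ (WV _ _ kn _ (vW n)) Vx; lra.
Qed.

Definition small (n : nat) (E : set (pow X)) : Prop :=
  forall i, (i <= n)%N ->
    exists V, [/\ open V, small_set n V & E `<=` [set x | V (x i)]].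

Lemma small_sub n E E' : E `<=` E' -> small n E' -> small n E.
Proof.
move=> EE' sE i /sE[V [oV sV E'V]]; exists V; split => //.
by move=> x /EE'; exact: E'V.
Qed.

Lemma near_small n (c : pow X) : cube G c -> exists E, nbhs c E /\ small n E.
Proof.
move=> Gc; have /choice[V VP] i := near_small_set n (Gc i).
exists [set x | forall i : 'I_n.+1, V i (x i)]; split.
  apply: (@filter_forall _ _ (fun (i : 'I_n.+1) (x : pow X) => V i (x i))
    (nbhs c) _) => i; apply: nbhs_coord.
  by have [oV Vc _] := VP i; apply: open_nbhs_nbhs.
move=> i ilen; exists (V i); have [oV _ sV] := VP i; split => // x /= Vx.
by have := Vx (Ordinal (ilen : i < n.+1)%N).
Qed.

Definition converges_fast (u : nat -> pow X) (l : pow X) : Prop :=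
  forall n i, (i <= n)%N -> d (u n i) (l i) <= rate R n.

Lemma eventually_const_limit u l N : converges_fast u l ->
  (forall n, (N <= n)%N -> u n = u N) -> l = u N.
Proof.
move=> ul uN; apply: funext => i; apply: esym; apply: (dist_le_eq dP) => e e0.
have [n ne] := rate_lt e0.
rewrite -(uN (maxn N (maxn n i)) (leq_maxl _ _)).
apply: le_trans (ul _ _ _) _; first by rewrite !leq_max leqnn !orbT.
apply: le_trans (ltW ne); apply: rate_le.
by rewrite !leq_max leqnn orbT.
Qed.

(** A sequence that moves only at times in [S], and is trapped in a small set from each such time
    on, is either eventually constant or convergent in each coordinate by [small_sets_cvg]. *)
Lemma nested_limit (u : nat -> pow X) (S : nat -> Prop) (E : nat -> set (pow X)) :
  (forall k, ~ S k -> u k.+1 = u k) ->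
  (forall k m, S k -> (k <= m)%N -> E k (u m)) ->
  (forall k, S k -> small k (E k)) ->
  exists l, converges_fast u l.
Proof.
move=> uS Eu sE.
have const n m : (n <= m)%N -> (forall k, (n <= k < m)%N -> ~ S k) -> u m = u n.
  move=> /subnK <-; elim: (m - n)%N => [//|j ih] nS.
  rewrite addSn uS; last by apply: nS; rewrite leq_addl addSn ltnS leqnn.
  by apply: ih => k /andP[nk kj]; apply: nS; rewrite nk addSn ltnS ltnW.
(* Nothing moves before the first time [k] in [S] after [n]; from then on the sequence stays in
   [E k], which contains [u k = u n]. *)
have close n m i : (n <= m)%N -> (i <= n)%N -> d (u n i) (u m i) < rate R n.
  move=> nm ilen.
  have [h|h] := pselect (exists k, (n <= k)%N && `[< S k >]); last first.
    rewrite (const n m nm) ?(distxx dP) ?rate_gt0 //.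
    move=> k /andP[nk _] Sk; apply: h; exists k; rewrite nk; exact/asboolP.
  case: (ex_minnP h) => k /andP[nk /asboolP Sk] kmin.
  have cst j : (n <= j <= k)%N -> u j = u n.
    move=> /andP[nj jk]; apply: const => // j' /andP[nj' j'j] Sj'.
    have := kmin j'; rewrite nj' asboolT // leqNgt (leq_trans j'j jk).
    by move=> /(_ isT).
  have [mk|km] := leqP m k; first by rewrite (cst m) ?nm ?(distxx dP) ?rate_gt0.
  rewrite -(cst k) ?nk ?leqnn //.
  have [V [_ /(small_set_le nk)[dV _] EV]] := sE k Sk i (leq_trans ilen nk).
  by apply: dV; apply: EV; apply: Eu => //; exact: ltnW.
have [h|h] := pselect (exists N, forall k, (N <= k)%N -> ~ S k).
  have [N NS] := h; exists (u N) => n i ilen.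
  have [nN|/ltnW Nn] := leqP n N; first exact/ltW/close.
  by rewrite (const N n Nn) ?(distxx dP) ?(ltW (rate_gt0 _ _)) // => k /andP[/NS].
have Sinf n : exists2 k, (n <= k)%N & S k.
  apply: contrapT => nS; apply: h; exists n => k nk Sk.
  by apply: nS; exists k.
have cvg i : exists li : X, (fun n => u n i) @ \oo --> li.
  apply: small_sets_cvg => n; have [k nk Sk] := Sinf (maxn n i).
  have [|V [oV sV EV]] := sE k Sk i; first by apply: leq_trans nk; rewrite leq_maxr.
  exists V; split => //.
    by apply: small_set_le sV; apply: leq_trans nk; rewrite leq_maxl.
  by apply: filterS (nbhs_infty_ge k) => m km; apply: EV; exact: Eu.
have [l lP] := choice cvg; exists l => n i ilen.
rewrite leNgt; apply/negP => lt.
have e0 : 0 < d (u n i) (l i) - rate R n by lra.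
have li := lP i _ (nbhs_dist dP (l i) e0).
have [m [nm um]] := filter_ex (filterI (nbhs_infty_ge n) li).
have := close n m i nm ilen; have := dist_triangle dP (u m i) (u n i) (l i).
rewrite /= (dist_sym dP (l i)) in um; lra.
Qed.

Lemma fast_limit_continuous (f : nat -> pow X -> pow X) (l : pow X -> pow X) :
  (forall n, continuous (f n)) -> (forall x, converges_fast (f^~ x) (l x)) ->
  continuous l.
Proof.
move=> cf fl x; apply: cvg_pow_comp => i N /(dist_nbhs dP)[e e0 eN].
have e3 : 0 < e / 3 by lra.
have [k ke] := rate_lt e3; pose n := maxn k i.
have ne : rate R n < e / 3.
  by apply: le_lt_trans ke; rewrite rate_le // leq_maxl.
have fx : \forall z \near x, d (f n x i) (f n z i) < e / 3.
  exact: (cf n x _ (nbhs_coord (nbhs_dist dP (f n x i) e3))).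
apply: filterS fx => z fz; apply: eN => /=.
have := fl x n i (leq_maxr _ _); have := fl z n i (leq_maxr _ _).
have := dist_triangle dP (f n x i) (l x i) (l z i).
have := dist_triangle dP (f n z i) (f n x i) (l z i).
rewrite (dist_sym dP (l x i) (f n x i)); lra.
Qed.

(** By continuity [lf (lg y)] is near [lf (g n y)], which is near [f n (g n y) = y] since the rate
    is uniform in the argument. *)
Lemma fast_limit_cancel (f g : nat -> pow X -> pow X) (lf lg : pow X -> pow X) :
  (forall n, continuous (f n)) -> (forall x, converges_fast (f^~ x) (lf x)) ->
  (forall x, converges_fast (g^~ x) (lg x)) ->
  (forall n, cancel (g n) (f n)) -> cancel lg lf.
Proof.
move=> cf fl gl gK y; apply: funext => i; apply: (dist_le_eq dP) => e e0.
have e2 : 0 < e / 2 by lra.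
have gy : (fun n => g n y) @ \oo --> lg y.
  apply: cvg_pow => j N /(dist_nbhs dP)[e' e'0 eN].
  have [k ke] := rate_lt e'0.
  apply: filterS (nbhs_infty_ge (maxn k j)) => n /=.
  rewrite geq_max => /andP[kn jn]; apply: eN => /=; rewrite (dist_sym dP).
  apply: le_lt_trans (gl y n j jn) _; apply: le_lt_trans ke; exact: rate_le.
have clf := fast_limit_continuous cf fl.
have near1 : \forall n \near \oo, d (lf (lg y) i) (lf (g n y) i) < e / 2.
  exact: (gy _ (clf _ _ (nbhs_coord (nbhs_dist dP (lf (lg y) i) e2)))).
have [k ke] := rate_lt e2.
have [n []] := filter_ex (filterI (nbhs_infty_ge (maxn k i)) near1).
rewrite /= geq_max => /andP[kn ilen] dn.
have ne : rate R n < e / 2 by apply: le_lt_trans ke; exact: rate_le.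
have := fl (g n y) n i ilen; rewrite gK (dist_sym dP) => dy.
have := dist_triangle dP (lf (g n y) i) (lf (lg y) i) (y i); lra.
Qed.

Lemma limit_homeomorphism (h g : nat -> pow X -> pow X) (V : nat -> set (pow X)) :
  (forall n, continuous (h n)) -> (forall n, continuous (g n)) ->
  (forall n, cancel (h n) (g n)) -> (forall n, cancel (g n) (h n)) ->
  (forall n, small n (V n)) -> (forall n, small n (h n @^-1` V n)) ->
  (forall m n, (m < n)%N -> V n `<=` V m \/ V n `<=` ~` V m) ->
  (forall n x, V n (h n x) <-> V n (h n.+1 x)) ->
  (forall n x, ~ V n (h n x) -> h n.+1 x = h n x) ->
  exists lh lg, [/\ continuous lh, continuous lg, cancel lh lg, cancel lg lh &
    forall x N, (forall n, (N <= n)%N -> h n x = h N x) -> lh x = h N x].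
Proof.
move=> ch cg hK gK sV sD nest Vh hV.
(* Later modifications act inside [V n] or off it, so no image enters or leaves [V n] after stage
   [n]. *)
have stay n m x : (n <= m)%N -> V n (h m x) <-> V n (h n x).
  move=> /subnK <-; elim: (m - n)%N => // k ih; rewrite addSn -ih.
  set j := (k + n)%N; have [Vj|nVj] := pselect (V j (h j x)); last first.
    by rewrite hV.
  have := leq_addl k n; rewrite leq_eqVlt => /orP[/eqP nj|nj].
    by rewrite nj -Vh.
  have Vj' : V j (h j.+1 x) by rewrite -Vh.
  by case: (nest n j nj) => sub; split => // Vn; [exact: sub|exact: sub|
    case: (sub _ Vj')|case: (sub _ Vj)].
have /choice[lh lhP] x : exists l, converges_fast (h^~ x) l.
  apply: (@nested_limit _ (fun k => V k (h k x)) V) => [k|k m Vk km|k _] //.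
    exact: hV.
  by rewrite stay.
(* For the inverses the point [y] is fixed: [g k y] changes only if [y] is in [V k], and the later
   preimages of [y] stay in the preimage of [V k] under [h k]. *)
have /choice[lg lgP] y : exists l, converges_fast (g^~ y) l.
  apply: (@nested_limit _ (fun k => V k y) (fun k => h k @^-1` V k)).
  - move=> k nVk; have := hV k (g k y); rewrite gK => /(_ nVk) hy.
    by rewrite -{1}hy hK.
  - by move=> k m Vk km /=; rewrite -(stay _ _ _ km) gK.
  - by move=> k _; exact: sD.
exists lh, lg; split.
- exact: fast_limit_continuous lhP.
- exact: fast_limit_continuous lgP.
- exact: fast_limit_cancel cg lgP lhP hK.
- exact: fast_limit_cancel ch lhP lgP gK.
- by move=> x N; exact: eventually_const_limit (lhP x).
Qed.

End limits.

(** * The back-and-forth construction *)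

Section back_and_forth.
Context {R : realType} {X : topologicalType} (G : set X).
Context (d : X -> X -> R) (rho : set_type G -> set_type G -> R).
Hypotheses (dP : compatible_metric d) (rhoP : compatible_metric rho).
Hypotheses (rho_complete : complete_metric rho) (G_dense : dense G).
Hypothesis X_basis : has_clopen_basis X.
Hypothesis X_nontrivial : exists a b : X, a <> b.
Context (A B : set (pow X)).
Hypotheses (AG : A `<=` cube G) (BG : B `<=` cube G).
Hypotheses (A_dense : dense A) (B_dense : dense B).

Let X_T1 := metric_T1 dP.
Let X_base a := metric_clopen_base dP a X_basis.
Let Y_T1 := pow_T1 X_T1.

(* [settled] is the set of points of [A] whose image, a point of [B], will not
   change any more; [cells] are the sets modified so far. *)
Record stage := Stage {
  fwd : pow X -> pow X;
  bwd : pow X -> pow X;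
  settled : set (pow X);
  cells : set (set (pow X)) }.

(** Closedness lets new boxes avoid the settled points. The last clause lets a small enough box be
    nested in or disjoint from every earlier cell. *)
Definition stage_ok (s : stage) : Prop :=
  [/\ carries (cube G) setT setT (fwd s) (bwd s),
      carries (cube G) setT setT (bwd s) (fwd s),
      closed (settled s),
      forall x, settled s x -> A x /\ B (fwd s x) &
      forall z : pow X, exists2 N, nbhs z N &
        forall C, cells s C -> N `<=` C \/ N `<=` ~` C].

Definition step_in (n : nat) (V : set (pow X)) (s s' : stage) : Prop :=
  [/\ small d rho n V, small d rho n (fwd s @^-1` V),
      forall C, cells s C -> V `<=` C \/ V `<=` ~` C &
      cells s' = cells s `|` [set V]] /\
  [/\ forall x, V (fwd s x) <-> V (fwd s' x),
      forall x, ~ V (fwd s x) -> fwd s' x = fwd s x,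
      settled s `<=` settled s' &
      forall x, settled s x -> ~ V (fwd s x)].

Lemma cells_add (C0 : set (set (pow X))) V : clopen V ->
  (forall z : pow X, exists2 N, nbhs z N & forall C, C0 C -> N `<=` C \/ N `<=` ~` C) ->
  forall z : pow X, exists2 N, nbhs z N &
    forall C, (C0 `|` [set V]) C -> N `<=` C \/ N `<=` ~` C.
Proof.
move=> cV C0P z; have [N Nz NC] := C0P z.
have [Vz|nVz] := pselect (V z).
  exists (N `&` V); first by apply: filterI => //; exact: clopen_near.
  by move=> C [/NC[] NsC|->]; [left|right|left] => y [Ny Vy] //; exact: NsC.
exists (N `&` ~` V).
  by apply: filterI => //; exact: (clopen_near (clopenC setT cV)).
by move=> C [/NC[] NsC|->]; [left|right|right] => y [Ny Vy] //; exact: NsC.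
Qed.

(** The empty cell satisfies every demand, so each stage can add one cell even when nothing has to
    move. *)
Lemma idle_step n s : stage_ok s -> exists s',
  [/\ stage_ok s', exists V, step_in n V s s', settled s' = settled s &
    fwd s' = fwd s].
Proof.
move=> [fb bf cF FAB cC].
have sm : small d rho n set0.
  move=> i _; exists set0; split; [exact: open0|by split=> x y []|by []].
exists (Stage (fwd s) (bwd s) (settled s) (cells s `|` [set set0])).
split => //; first by split => //; apply: cells_add => //; exact: clopen0.
exists set0; split; last by split => // x _ [].
by split => // C _; left.
Qed.

(** All requirements hold on a neighbourhood of [c]; those on preimages are pulled back along the
    continuous [bwd s]. *)
Lemma small_box n s c : stage_ok s -> cube G c -> ~ settled s (bwd s c) ->
  exists V, [/\ is_box V, V c, small d rho n V, small d rho n (fwd s @^-1` V) &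
    (forall x, settled s x -> ~ V (fwd s x)) /\
    (forall C, cells s C -> V `<=` C \/ V `<=` ~` C)].
Proof.
move=> [fb bf cF FAB cC] Gc nFc.
have [_ _ Gbc cbc] := bf c I.
have [E [Ec sE]] := near_small dP rhoP n Gc.
have [E' [E'c sE']] := near_small dP rhoP n (Gbc Gc).
have [N Nc NC] := cC c.
have nF : nbhs (bwd s c) (~` settled s).
  by apply: open_nbhs_nbhs; split => //; exact: closed_openC.
have E'b : \forall y \near c, E' (bwd s y) := cbc _ E'c.
have nFb : \forall y \near c, ~ settled s (bwd s y) := cbc _ nF.
have [V [bV Vc VN]] := nbhs_box X_T1 X_base G_dense X_nontrivial
  (filterI (filterI Ec Nc) (filterI E'b nFb)).
exists V; split => //.
- by apply: small_sub sE => y /VN[[]].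
- apply: small_sub sE' => x /VN[_ [+ _]].
  by have [_ -> _ _] := fb x I.
- split => [x Fx /VN[_ [_]]|C /NC[] NsC].
  + by have [_ -> _ _] := fb x I.
  + by left => y /VN[[_ /NsC]].
  + by right => y /VN[[_ /NsC]].
Qed.

Lemma moving_step n s V a b : stage_ok s -> is_box V ->
  small d rho n V -> small d rho n (fwd s @^-1` V) ->
  (forall x, settled s x -> ~ V (fwd s x)) ->
  (forall C, cells s C -> V `<=` C \/ V `<=` ~` C) ->
  A a -> B b -> V (fwd s a) -> V b ->
  exists s', [/\ stage_ok s', exists V, step_in n V s s', settled s' a &
    fwd s' a = b].
Proof.
move=> [fb bf cF FAB cC] bV sV sD VF VC Aa Bb Va Vb.
have [_ faK /(_ (AG Aa)) Gfa _] := fb a I.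
have [f [g [fg gf fz [fout fin]]]] := box_homogeneity X_T1 X_base G_dense
  X_nontrivial bV Va Vb Gfa (BG Bb).
have VfE x : V x <-> V (f x).
  split; first exact: fin.
  by move=> Vfx; apply: contrapT => nVx; move: Vfx; rewrite fout.
exists (Stage (f \o fwd s) (bwd s \o g) (settled s `|` [set a])
  (cells s `|` [set V])); split => //=; last by right.
- split => /=.
  + exact: carries_comp fb fg.
  + exact: carries_comp gf bf.
  (* Singletons are closed by T1 separation. *)
  + apply: closedU => // x clx; apply: Y_T1 => N Nx.
    by have [y [-> ]] := clx _ Nx.
  + move=> x [Fx|->]; last by rewrite fz.
    by rewrite fout; [exact: FAB|exact: VF].
  + by apply: cells_add => //; exact: is_box_clopen.
- exists V; split; split => //=.
  by move=> x nV; rewrite fout.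
Qed.

Lemma forth_step n s a : stage_ok s -> A a ->
  exists s', [/\ stage_ok s', exists V, step_in n V s s' & settled s' a].
Proof.
move=> sP Aa; have [Fa|nFa] := pselect (settled s a).
  have [s' [s'P sV sE _]] := idle_step n sP; exists s'; split => //.
  by rewrite sE.
have [fb bf _ _ _] := sP; have [_ faK Gfa _] := fb a I.
have [|V [bV Va sV sD [VF VC]]] := small_box n sP (Gfa (AG Aa)).
  by rewrite faK.
have [b [Vb Bb]] : V `&` B !=set0.
  by apply: B_dense; [exists (fwd s a)|have [] := is_box_clopen bV].
have [s' [s'P sV' s'a _]] := moving_step sP bV sV sD VF VC Aa Bb Va Vb.
by exists s'.
Qed.

Lemma back_step n s b : stage_ok s -> B b ->
  exists s', [/\ stage_ok s', exists V, step_in n V s s' &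
    exists2 a, settled s' a & fwd s' a = b].
Proof.
move=> sP Bb; have [fb bf _ _ _] := sP; have [_ gbK _ _] := bf b I.
have [Fb|nFb] := pselect (settled s (bwd s b)).
  have [s' [s'P sV sE fE]] := idle_step n sP; exists s'; split => //.
  by exists (bwd s b); rewrite ?sE ?fE.
have [V [bV Vb sV sD [VF VC]]] := small_box n sP (BG Bb) nFb.
(* The preimage of the box is open and contains [bwd s b], so it meets the dense set [A]. *)
have [a [Va Aa]] : (fwd s @^-1` V) `&` A !=set0.
  apply: A_dense; first by exists (bwd s b); rewrite /= gbK.
  apply: open_comp => [x _|]; first by have [_ _ _] := fb x I.
  by have [] := is_box_clopen bV.
have [s' [s'P sV' s'a s'b]] := moving_step sP bV sV sD VF VC Aa Bb Va Vb.
by exists s'; split => //; exists a.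
Qed.

Lemma back_and_forth : countable A -> countable B ->
  exists2 h : pow X -> pow X, homeomorphism h & h @` A = B.
Proof.
move=> /countable_injP[iA iAP] /countable_injP[iB iBP].
pose T := {s : stage | stage_ok s}.
(* Even stages settle points of [A] and odd stages reach points of [B]; an index belonging to no
   point gets an idle step. *)
pose good (n : nat) (s s' : stage) := [/\ exists V, step_in n V s s',
  forall a, A a -> n = (iA a).*2 -> settled s' a &
  forall b, B b -> n = (iB b).*2.+1 -> exists2 a, settled s' a & fwd s' a = b].
have step (ns : nat * T) : exists s' : T, good ns.1 (sval ns.2) (sval s').
  case: ns => n s /=; have sP := svalP s.
  have [[a [Aa na]]|nA] := pselect (exists a, A a /\ n = (iA a).*2).
    have [s' [s'P sV s'a]] := forth_step n sP Aa.
    exists (exist _ s' s'P); split => //= [a' Aa'|b Bb].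
      rewrite na => /double_inj eq_i.
      by rewrite -(iAP _ _ (mem_set Aa) (mem_set Aa') eq_i).
    by rewrite na => /(congr1 odd); rewrite /= !odd_double.
  have [[b [Bb nb]]|nB] := pselect (exists b, B b /\ n = (iB b).*2.+1).
    have [s' [s'P sV s'b]] := back_step n sP Bb.
    exists (exist _ s' s'P); split => //= [a Aa na|b' Bb'].
      by case: nA; exists a.
    rewrite nb => -[] /double_inj eq_i.
    by rewrite -(iBP _ _ (mem_set Bb) (mem_set Bb') eq_i).
  have [s' [s'P sV _ _]] := idle_step n sP.
  exists (exist _ s' s'P); split => //= [a Aa na|b Bb nb].
    by case: nA; exists a.
  by case: nB; exists b.
have [next nextP] := choice step.
have s0P : stage_ok (Stage id id set0 set0).
  split => //=; try exact: carries_id; first exact: closed0.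
  by move=> z; exists setT => //; exact: filterT.
pose st := nat_rect (fun=> T) (exist _ _ s0P) (fun n s => next (n, s)).
pose s n := sval (st n).
have sok n : stage_ok (s n) by exact: svalP.
have sgood n : good n (s n) (s n.+1) by exact: (nextP (n, st n)).
have /choice[V VP] n : exists V, step_in n V (s n) (s n.+1) by case: (sgood n).
have cellsV m n : (m < n)%N -> cells (s n) (V m).
  elim: n => // n ih; rewrite ltnS leq_eqVlt; have [[_ _ _ ->] _] := VP n.
  by move=> /orP[/eqP ->|/ih]; [right|left].
have [|||||||||lh [lg [clh clg lhK lgK lhE]]] :=
    @limit_homeomorphism R X G d rho dP rho_complete G_dense
      (fun n => fwd (s n)) (fun n => bwd (s n)) V.
- by move=> n x; have [fb _ _ _ _] := sok n; have [] := fb x I.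
- by move=> n x; have [_ bf _ _ _] := sok n; have [] := bf x I.
- by move=> n x; have [fb _ _ _ _] := sok n; have [] := fb x I.
- by move=> n x; have [_ bf _ _ _] := sok n; have [] := bf x I.
- by move=> n; have [[]] := VP n.
- by move=> n; have [[]] := VP n.
- by move=> m n mn; have [[_ _ nest _] _] := VP n; exact: nest (cellsV _ _ mn).
- by move=> n; have [_ []] := VP n.
- by move=> n; have [_ []] := VP n.
(* Later cells avoid the images of settled points, so these images are final. *)
have settledE n x : settled (s n) x -> lh x = fwd (s n) x.
  move=> Fx; apply: lhE => m /subnK <-.
  suff [] : fwd (s (m - n + n)%N) x = fwd (s n) x /\
    settled (s (m - n + n)%N) x by [].
  elim: (m - n)%N => // k [ih Fk]; rewrite addSn.
  have [_ [_ out sub avoid]] := VP (k + n)%N.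
  by rewrite out ?ih; [split => //; exact: sub|rewrite -ih; exact: avoid].
exists lh; first by exists lg.
rewrite eqEsubset; split => [_ [a Aa <-]|b Bb].
  have [_ /(_ a Aa erefl) Fa _] := sgood (iA a).*2.
  rewrite (settledE _ _ Fa); have [_ _ _ FAB _] := sok (iA a).*2.+1.
  by case: (FAB _ Fa).
have [_ _ /(_ b Bb erefl)[a Fa <-]] := sgood (iB b).*2.+1.
exists a; last exact: settledE.
by have [_ _ _ FAB _] := sok (iB b).*2.+2; case: (FAB _ Fa).
Qed.

End back_and_forth.

(** * Countable dense homogeneity of the power *)

Theorem theorem9p4 (R : realType) (X : topologicalType) :
  separable_metrizable R X ->
  has_clopen_basis X ->
  countably_controlled R X ->
  countable_dense_homogeneous {ptws nat -> X}.
Proof.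
move=> [_ [d dP]] basisX ccX A B cA dA cB dB.
(* If [X] has at most one point, so has the power, and its only dense subset is the whole power. *)
have [ne|all_eq] := pselect (exists a b : X, a <> b); last first.
  have full (C : set (pow X)) : dense C -> C = setT.
    move=> dC; rewrite eqEsubset; split => // x _.
    have [|y [_ Cy]] := dC setT _ openT; first by exists x.
    suff -> : x = y by [].
    apply: funext => i; apply: contrapT => xy; apply: all_eq.
    by exists (x i), (y i).
  exists id; first by exists id; split => // x; exact: cvg_id.
  by rewrite image_id (full A) // (full B).
pose C (b : bool) := if b then A else B.
pose D := \bigcup_(ib in [set: nat * bool]) [set x ib.1 | x in C ib.2].
have cD : countable D.
  apply: bigcup_countable => [|[i b] _]; first exact: countableP.
  by apply: (sub_countable (card_image_le _ _)); case: b.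
have [G DG [_ [rho [rhoP rho_complete]]]] := ccX D cD.
have inG b x : C b x -> cube G x.
  by move=> Cx i; apply: DG; exists (i, b) => //; exists x.
have dG : dense G.
  (* Some point of [A] has its coordinate [0] in [O], and that coordinate lies in [G]. *)
  move=> O [x Ox] oO.
  have [||y [Oy Ay]] := dA [set y | O (y 0)].
  - by exists (fun=> x).
  - apply: (@open_comp _ _ (fun y : pow X => y 0)) => // y _; exact: coord_cvg.
  - by exists (y 0); split => //; exact: (inG true y).
apply: (back_and_forth dP rhoP rho_complete dG basisX ne) => //.
  exact: (inG true).
exact: (inG false).
Qed.
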